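(* Let $S_2=\{(2,-1,-1),(3,-1,0)\}$. If $(t_2,t_3,t_4)\in S_2$, then for all integers $n\geq 0$, $$a_{2^{t_2}3^{t_3}4^{t_4}}(3n)>0,\qquad a_{2^{t_2}3^{t_3}4^{t_4}}(3n+1)=0,\qquad a_{2^{t_2}3^{t_3}4^{t_4}}(3n+2)<0.$$
   Context: For $|q|<1$ (or as formal power series in $q$) let $f_j:=(q^j;q^j)_\infty=\prod_{k\ge 1}(1-q^{jk})$ for each positive integer $j$. For a positive integer $m$ and integers $t_1,\dots,t_m$ (possibly zero or negative), the integers $a_{1^{t_1}2^{t_2}\cdots m^{t_m}}(n)$, $n\ge 0$, are defined by $\sum_{n=0}^\infty a_{1^{t_1}2^{t_2}\cdots m^{t_m}}(n)q^n=f_1^{t_1}f_2^{t_2}\cdots f_m^{t_m}$. Factors with exponent $0$ may be omitted from the notation; so $\sum_{n\ge0} a_{2^{t_2}3^{t_3}4^{t_4}}(n)q^n=f_2^{t_2}f_3^{t_3}f_4^{t_4}$. *)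

(* Defs.v *)
From HB Require Import structures.
From mathcomp Require Import all_boot all_order all_algebra.
From mathcomp Require Import boolp.

Set Implicit Arguments.
Unset Strict Implicit.
Unset Printing Implicit Defensive.

Import Order.TTheory GRing.Theory Num.Theory.
Local Open Scope ring_scope.

Declare Scope fps_scope.

(* [FPS a] is the formal power series \sum_n a n q^n. The wrapper keeps the
   Cauchy product apart from the pointwise product on functions. *)
Record fps (R : Type) := FPS { coefs :> nat -> R }.

HB.instance Definition _ (R : Type) := gen_eqMixin (fps R).
HB.instance Definition _ (R : Type) := gen_choiceMixin (fps R).

Lemma fpsP (R : Type) (a b : fps R) : (forall n, a n = b n) -> a = b.
Proof. by case: a b => [a] [b] /= /funext ->. Qed.

Section FpsZmod.
Variable R : zmodType.
Implicit Types a b c : fps R.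

Definition fps_zero : fps R := FPS (fun=> 0).
Definition fps_opp a : fps R := FPS (fun n => - a n).
Definition fps_add a b : fps R := FPS (fun n => a n + b n).

Fact fps_addA : associative fps_add.
Proof. by move=> a b c; apply: fpsP => n /=; rewrite addrA. Qed.
Fact fps_addC : commutative fps_add.
Proof. by move=> a b; apply: fpsP => n /=; rewrite addrC. Qed.
Fact fps_add0 : left_id fps_zero fps_add.
Proof. by move=> a; apply: fpsP => n /=; rewrite add0r. Qed.
Fact fps_addN : left_inverse fps_zero fps_opp fps_add.
Proof. by move=> a; apply: fpsP => n /=; rewrite addNr. Qed.

HB.instance Definition _ :=
  GRing.isZmodule.Build (fps R) fps_addA fps_addC fps_add0 fps_addN.

Lemma fpsE0 n : (0 : fps R) n = 0. Proof. by []. Qed.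
Lemma fpsED a b n : (a + b) n = a n + b n. Proof. by []. Qed.
Lemma fpsEN a n : (- a) n = - a n. Proof. by []. Qed.
End FpsZmod.

Section FpsRing.
Variable R : comNzRingType.
Implicit Types a b c : fps R.

Definition fpsXn (k : nat) : fps R := FPS (fun n => (n == k)%:R).
Definition fps_mul a b : fps R :=
  FPS (fun n => \sum_(i < n.+1) a i * b (n - i)%N).

Let trunc m a : {poly R} := \poly_(i < m.+1) a i.

Let truncE m a n : (n <= m)%N -> (trunc m a)`_n = a n.
Proof. by move=> le_nm; rewrite coef_poly ltnS le_nm. Qed.

Let truncM m a b n : (n <= m)%N ->
  (trunc m a * trunc m b)`_n = fps_mul a b n.
Proof.
move=> le_nm; rewrite coefM; apply: eq_bigr => i _.
by rewrite !truncE ?(leq_trans (leq_subr _ _)) // (leq_trans _ le_nm) -1?ltnS.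
Qed.

Let truncMl m a b c n : (n <= m)%N ->
  (trunc m a * trunc m b * trunc m c)`_n = fps_mul (fps_mul a b) c n.
Proof.
move=> le_nm; rewrite coefM; apply: eq_bigr => i _.
by rewrite truncM ?truncE ?(leq_trans (leq_subr _ _)) // (leq_trans _ le_nm)
  -1?ltnS.
Qed.

Fact fps_mulC : commutative fps_mul.
Proof.
by move=> a b; apply: fpsP => n; rewrite -!(truncM _ _ (leqnn n)) mulrC.
Qed.
Fact fps_mulA : associative fps_mul.
Proof.
move=> a b c; apply: fpsP => n; rewrite -(truncMl _ _ _ (leqnn n)).
by rewrite (fps_mulC a) -(truncMl _ _ _ (leqnn n)) mulrC mulrA.
Qed.
Fact fps_mul1 : left_id (fpsXn 0) fps_mul.
Proof.
move=> a; apply: fpsP => n /=; rewrite big_ord_recl /= mul1r subn0.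
by rewrite big1 ?addr0 // => i _; rewrite mul0r.
Qed.
Fact fps_mulDl : left_distributive fps_mul +%R.
Proof.
move=> a b c; apply: fpsP => n; rewrite fpsED /= -big_split /=.
by apply: eq_bigr => i _; rewrite mulrDl.
Qed.
Fact fps_one_neq0 : fpsXn 0 != 0.
Proof.
by apply/eqP => /(congr1 (fun a : fps R => a 0%N)) /= /eqP; rewrite oner_eq0.
Qed.

HB.instance Definition _ := GRing.Zmodule_isComNzRing.Build (fps R)
  fps_mulA fps_mulC fps_mul1 fps_mulDl fps_one_neq0.

Lemma fpsE1 n : (1 : fps R) n = (n == 0%N)%:R. Proof. by []. Qed.
Lemma fpsEM a b n : (a * b) n = \sum_(i < n.+1) a i * b (n - i)%N.
Proof. by []. Qed.
Lemma fpsEXn k n : fpsXn k n = (n == k)%:R. Proof. by []. Qed.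
End FpsRing.

Notation "''q^' k" := (fpsXn _ k)
  (at level 1, k at level 2, format "''q^' k") : fps_scope.
Local Open Scope fps_scope.

Section FpsUnit.
Variable R : comUnitRingType.
Implicit Types a b : fps R.

Definition fps_unit : {pred fps R} := fun a => a 0%N \is a GRing.unit.

(* The first n coefficients of the inverse of a, obtained by solving
   a b = 1 for the coefficients of b one after the other. *)
Fixpoint fps_inv_seq a (n : nat) : seq R :=
  if n is m.+1 then
    let s := fps_inv_seq a m in
    rcons s ((a 0%N)^-1 * ((m == 0%N)%:R - \sum_(i < m) a (m - i)%N * s`_i))
  else [::].

Definition fps_inv a : fps R :=
  if fps_unit a then FPS (fun n => (fps_inv_seq a n.+1)`_n) else a.

Let size_inv_seq a n : size (fps_inv_seq a n) = n.
Proof. by elim: n => //= n IHn; rewrite size_rcons IHn. Qed.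

Let nth_inv_seq a n i : (i < n)%N ->
  (fps_inv_seq a n)`_i = (fps_inv_seq a i.+1)`_i.
Proof.
elim: n => // n IHn; rewrite ltnS leq_eqVlt => /orP[/eqP-> //|lt_in].
by rewrite [in LHS]/= nth_rcons size_inv_seq lt_in IHn.
Qed.

Fact fps_mulVx : {in fps_unit, left_inverse 1 fps_inv *%R}.
Proof.
move=> a Ua; have Ua' : fps_unit a by [].
rewrite mulrC; apply: fpsP => n.
rewrite mulrC fpsEM big_ord_recr /= subnn /fps_inv Ua' /=.
rewrite nth_rcons size_inv_seq ltnn eqxx.
rewrite mulrAC mulVr // mul1r -fpsE1.
rewrite (eq_bigr (fun i : 'I_n => a (n - i)%N * (fps_inv_seq a n)`_i)).
  by rewrite subrKC.
by move=> i _; rewrite mulrC (nth_inv_seq _ (ltn_ord i)).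
Qed.

Fact fps_unitPl a b : b * a = 1 -> fps_unit a.
Proof.
move=> /(congr1 (fun c : fps R => c 0%N)).
rewrite fpsEM big_ord_recl big_ord0 addr0 /= => ba1.
by apply/unitrPr; exists (b 0%N); rewrite mulrC.
Qed.

Fact fps_inv_out : {in [predC fps_unit], fps_inv =1 id}.
Proof. by move=> a /negPf Ua; rewrite /fps_inv [fps_unit a]Ua. Qed.

HB.instance Definition _ := GRing.ComNzRing_hasMulInverse.Build (fps R)
  fps_mulVx fps_unitPl fps_inv_out.

Lemma fps_unitE a : (a \is a GRing.unit) = (a 0%N \is a GRing.unit).
Proof. by []. Qed.
End FpsUnit.

(* f_j = \prod_(k >= 1) (1 - q^(j k)), for j >= 1. The factors with k > n do
   not change the coefficient of q^n, so the infinite product is read off its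
   finite subproducts; see [eulerf_stable]. *)
Definition eulerf (j : nat) : fps int :=
  FPS (fun n => (\prod_(1 <= k < n.+1) (1 - 'q^(j * k)%N)) n).

Lemma eulerf_stable (j n N : nat) : (0 < j)%N -> (n <= N)%N ->
  (\prod_(1 <= k < N.+1) (1 - 'q^(j * k)%N) : fps int) n = eulerf j n.
Proof.
move=> j_gt0; elim: N => [|N IHN]; first by rewrite leqn0 => /eqP->.
rewrite leq_eqVlt => /orP[/eqP-> //|]; rewrite ltnS => le_nN.
set P := \prod_(1 <= k < N.+1) _ in IHN.
have -> : \prod_(1 <= k < N.+2) (1 - 'q^(j * k)%N) = P - P * 'q^(j * N.+1)%N.
  by rewrite big_nat_recr //= mulrBr mulr1.
rewrite fpsED fpsEN IHN // fpsEM big1 ?subr0 //.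
move=> i _; rewrite fpsEXn; case: eqP => [eq_ni|_]; last by rewrite mulr0.
have := leq_trans (leq_pmull N.+1 j_gt0) (leq_trans _ le_nN).
by rewrite -eq_ni leq_subr ltnn => /(_ isT).
Qed.

Lemma eulerf_unit (j : nat) : eulerf j \is a GRing.unit.
Proof. by rewrite fps_unitE /= big_geq. Qed.

(* For t = [:: t_1; ...; t_m], the coefficient of q^n in
   f_1^t_1 f_2^t_2 ... f_m^t_m. *)
Definition eta_coef (t : seq int) (n : nat) : int :=
  (\prod_(j < size t) eulerf j.+1 ^ t`_j) n.

Definition S2 : seq (int * int * int) := [:: (2, -1, -1); (3, -1, 0)].

(* Main.v *)
(* Let phi = f(-q, -q), psi = f(q^3, q), A = f(q^2, q) and B = f(-q^5, -q), where
   f(a, b) = \sum_(n in Z) a^(n(n+1)/2) b^(n(n-1)/2), and let D_k substitute q^k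
   for q. Splitting the summation index modulo 3 gives
     phi = D_9 phi - 2 q D_3 B   and   psi = D_3 A + q D_9 psi,
   and the Jacobi triple product gives
     f_1^2 = f_2 phi,  f_2^2 = f_1 psi,  f_2 D_3 phi = f_1 A,
     f_2 B = f_1 D_3 psi.
   Hence f_2^2 / f_4 = D_2 phi and f_2^3 = (D_2 phi)^2 D_2 psi split modulo 3;
   the q^(3n+1) part vanishes (in the second case because A B = D_3 (phi psi)),
   and after dividing by f_1 = f_2^2 / psi the other two parts become, with
   A_2 = D_2 A and V = D_6 psi,
     A_2 psi / (f_2 f_4)                     and  - 2 V psi / (f_2 f_4),
     psi (A_2^3 + 4 q^2 V^3) / f_4^2         and  - 3 A_2^2 V psi / f_4^2.
   All factors have nonnegative coefficients. Strict positivity comes from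
   psi / f_2 and psi A_2 / f_4: psi and psi A_2 are positive in degrees < 2,
   resp. < 4, and 1 / f_2, 1 / f_4 are positive in all degrees divisible by 2,
   resp. 4. *)
Require Import Defs.
From HB Require Import structures.
From mathcomp Require Import all_boot all_order all_algebra.
From mathcomp Require Import ring zify.

Set Implicit Arguments.
Unset Strict Implicit.
Unset Printing Implicit Defensive.

Import Order.TTheory GRing.Theory Num.Theory.
Local Open Scope ring_scope.
Local Open Scope fps_scope.

(** * Convergence of power series *)

Section Convergence.
Variable R : comUnitRingType.
Implicit Types (x y z : fps R) (u v : nat -> fps R) (m n N : nat).

Definition eqq N x y := forall n, (n < N)%N -> x n = y n.

Lemma eqq_sym N x y : eqq N x y -> eqq N y x.
Proof. by move=> h n /h. Qed.

Lemma eqq_trans N x y z : eqq N x y -> eqq N y z -> eqq N x z.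
Proof. by move=> h k n lt; rewrite h ?k. Qed.

Lemma eqqW m N x y : (m <= N)%N -> eqq N x y -> eqq m x y.
Proof. by move=> le h n lt; apply/h/(leq_trans lt). Qed.

Lemma eqqD N x x' y y' : eqq N x x' -> eqq N y y' -> eqq N (x + y) (x' + y').
Proof. by move=> h k n lt; rewrite !fpsED h ?k. Qed.

Lemma eqqN N x x' : eqq N x x' -> eqq N (- x) (- x').
Proof. by move=> h n lt; rewrite !fpsEN h. Qed.

Lemma eqqM N x x' y y' : eqq N x x' -> eqq N y y' -> eqq N (x * y) (x' * y').
Proof.
move=> h k n lt; rewrite !fpsEM; apply: eq_bigr => i _.
by rewrite h ?k // (leq_ltn_trans _ lt) // ?leq_subr // -ltnS.
Qed.

Lemma eqqM0 m n x y : eqq m x 0 -> eqq n y 0 -> eqq (m + n) (x * y) 0.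
Proof.
move=> h k i lt; rewrite fpsEM fpsE0 big1 // => j _.
have [ltj|lej] := ltnP j m; first by rewrite h // mul0r.
rewrite (k (i - j)%N) ?mulr0 // ltn_subLR; last by rewrite -ltnS.
by rewrite (leq_trans lt) // leq_add2r.
Qed.

Lemma eqqX0 n x : eqq 1 x 0 -> eqq n (x ^+ n) 0.
Proof.
by move=> h; elim: n => [|n IHn] //; rewrite exprS -[n.+1]add1n; apply: eqqM0.
Qed.

Lemma eqq0_M N x y : eqq N x 0 -> eqq N (x * y) 0.
Proof. by move=> h; rewrite -[0](mul0r y); apply: eqqM. Qed.

Lemma eqq_sum N (I : Type) (r : seq I) (P : pred I) (F G : I -> fps R) :
  (forall i, P i -> eqq N (F i) (G i)) ->
  eqq N (\sum_(i <- r | P i) F i) (\sum_(i <- r | P i) G i).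
Proof. by move=> h; elim/big_ind2: _ => // *; apply: eqqD. Qed.

Lemma eqq_prod N (I : Type) (r : seq I) (P : pred I) (F G : I -> fps R) :
  (forall i, P i -> eqq N (F i) (G i)) ->
  eqq N (\prod_(i <- r | P i) F i) (\prod_(i <- r | P i) G i).
Proof. by move=> h; elim/big_ind2: _ => // *; apply: eqqM. Qed.

Lemma eqq_unit N x y : (0 < N)%N -> eqq N x y -> x \is a GRing.unit ->
  y \is a GRing.unit.
Proof. by move=> N0 h; rewrite !fps_unitE h. Qed.

Lemma eqq_cancel N x y z : x \is a GRing.unit ->
  eqq N (x * y) (x * z) -> eqq N y z.
Proof.
by move=> Ux h; rewrite -[y](mulKr Ux) -[z](mulKr Ux); apply: eqqM.
Qed.

Lemma eqqV N x y : eqq N x y -> x \is a GRing.unit -> eqq N x^-1 y^-1.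
Proof.
case: N => [//|N] h Ux; apply: (eqq_cancel Ux); rewrite divrr //.
have Uy := eqq_unit (ltn0Sn N) h Ux.
by rewrite -(divrr Uy); apply/eqq_sym/eqqM.
Qed.

(** Convergence at a fixed rate: the N-th term is already exact modulo q^N, so limit arguments need
    no thresholds. *)
Definition tends u x := forall N, eqq N x (u N).

Lemma tends_unique u x y : tends u x -> tends u y -> x = y.
Proof. by move=> h k; apply: fpsP => n; rewrite (h n.+1) ?(k n.+1). Qed.

Lemma tends_sub (r : nat -> nat) u x : (forall N, N <= r N)%N -> tends u x ->
  tends (fun N => u (r N)) x.
Proof. by move=> ler h N; apply: (eqqW (ler N)). Qed.

Lemma tends_cauchy u : (forall N, eqq N (u N.+1) (u N)) ->
  tends u (FPS (fun n => u n.+1 n)).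
Proof.
move=> h N n /= ltnN; rewrite -(subnK ltnN).
elim: (N - _)%N => [//|d ->]; rewrite addSn; apply/esym/h.
by rewrite addnS ltnS leq_addl.
Qed.

(** Total definitions; they give the actual limits once the k-th factor is 1, resp. the k-th summand
    is 0, modulo q^k. *)
Definition infprod u : fps R := FPS (fun n => (\prod_(k < n.+1) u k) n).
Definition infsum u : fps R := FPS (fun n => (\sum_(k < n.+1) u k) n).

Lemma tends_infprod u : (forall k, eqq k (u k) 1) ->
  tends (fun N => \prod_(k < N) u k) (infprod u).
Proof.
move=> h; apply: (tends_cauchy (u := fun N => \prod_(k < N) u k)) => N.
by rewrite big_ord_recr /= -[X in eqq _ _ X]mulr1; apply: eqqM.
Qed.

Lemma tends_infsum u : (forall k, eqq k (u k) 0) ->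
  tends (fun N => \sum_(k < N) u k) (infsum u).
Proof.
move=> h; apply: (tends_cauchy (u := fun N => \sum_(k < N) u k)) => N.
by rewrite big_ord_recr /= -[X in eqq _ _ X]addr0; apply: eqqD.
Qed.

Lemma big_ord_block (T : Type) (idx : T) (op : Monoid.law idx) (m N : nat)
    (F : nat -> T) :
  \big[op/idx]_(k < N) \big[op/idx]_(r < m) F (m * k + r)%N =
  \big[op/idx]_(k < m * N) F k.
Proof.
elim: N => [|N IHN]; first by rewrite muln0 !big_ord0.
by rewrite big_ord_recr /= IHN mulnSr big_split_ord.
Qed.

(** The regrouped partial sums are the partial sums of [u] of length m N, a subsequence with the
    same limit. This is how a summation index is split modulo m. *)
Lemma infsum_block m u : (0 < m)%N -> (forall k, eqq k (u k) 0) ->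
  infsum u = infsum (fun k => \sum_(r < m) u (m * k + r)%N).
Proof.
move=> m_gt0 h.
apply: (@tends_unique (fun N => \sum_(k < N) \sum_(r < m) u (m * k + r)%N)).
  move=> N; rewrite (big_ord_block _ m N u).
  by apply: (tends_sub (r := muln m) _ (tends_infsum h)) => n; apply: leq_pmull.
apply: tends_infsum => k; apply: (@eqq_trans _ _ (\sum_(r < m) 0)); last first.
  by rewrite big1.
apply: eqq_sum => r _; apply: (eqqW _ (h _)).
by rewrite (leq_trans (leq_pmull k m_gt0)) // leq_addr.
Qed.

Lemma infprod_block m u : (0 < m)%N -> (forall k, eqq k (u k) 1) ->
  infprod u = infprod (fun k => \prod_(r < m) u (m * k + r)%N).
Proof.
move=> m_gt0 h.
apply: (@tends_unique (fun N => \prod_(k < N) \prod_(r < m) u (m * k + r)%N)).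
  move=> N; rewrite (big_ord_block _ m N u).
  by apply: (tends_sub (r := muln m) _ (tends_infprod h)) => n; apply: leq_pmull.
apply: tends_infprod => k; apply: (@eqq_trans _ _ (\prod_(r < m) 1)); last first.
  by rewrite big1.
apply: eqq_prod => r _; apply: (eqqW _ (h _)).
by rewrite (leq_trans (leq_pmull k m_gt0)) // leq_addr.
Qed.

Lemma infprodM u v : (forall k, eqq k (u k) 1) -> (forall k, eqq k (v k) 1) ->
  infprod (fun k => u k * v k) = infprod u * infprod v.
Proof.
move=> h k; apply: (tends_unique (tends_infprod _)) => [j|N].
  by rewrite -[1]mulr1; apply: eqqM.
by rewrite big_split; apply: eqqM; apply: tends_infprod.
Qed.

Lemma eq_infprod u v : u =1 v -> infprod u = infprod v.
Proof. by move=> h; apply: fpsP => n /=; under eq_bigr do rewrite h. Qed.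

Lemma eq_infsum u v : u =1 v -> infsum u = infsum v.
Proof. by move=> h; apply: fpsP => n /=; under eq_bigr do rewrite h. Qed.

Lemma infsumD u v : infsum (fun k => u k + v k) = infsum u + infsum v.
Proof. by apply: fpsP => n; rewrite /= big_split. Qed.

Lemma infsumZ x u : (forall k, eqq k (u k) 0) ->
  infsum (fun k => x * u k) = x * infsum u.
Proof.
move=> h; apply: (tends_unique (tends_infsum _)) => [k|N].
  by rewrite mulrC; apply: eqq0_M.
by rewrite -mulr_sumr; apply: eqqM => //; apply: tends_infsum.
Qed.

Lemma infsum_recl u : (forall k, eqq k (u k) 0) ->
  infsum u = u 0%N + infsum (fun k => u k.+1).
Proof.
move=> h; have h1 k : eqq k (u k.+1) 0 by apply: (eqqW _ (h _)).
apply: (@tends_unique (fun N => \sum_(k < N.+1) u k)).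
  by apply: (tends_sub (r := succn) _ (tends_infsum h)) => n.
move=> N; rewrite big_ord_recl; apply: eqqD => //.
exact: tends_infsum.
Qed.

Lemma mulXnE k x n :
  ('q^k * x) n = if (n < k)%N then 0 else x (n - k)%N.
Proof.
rewrite fpsEM; case: ltnP => [ltnk|lekn].
  rewrite big1 // => i _; rewrite fpsEXn; case: eqP => [ik|]; last by rewrite mul0r.
  by have := ltn_ord i; rewrite ik ltnS leqNgt ltnk.
have lt_k : (k < n.+1)%N by [].
rewrite (bigD1 (Ordinal lt_k)) //= eqxx mul1r big1 ?addr0 // => i.
by rewrite -val_eqE /= => /negPf ->; rewrite mul0r.
Qed.

Lemma mulXn i j : 'q^i * 'q^j = 'q^(i + j)%N :> fps R.
Proof.
apply: fpsP => n; rewrite mulXnE !fpsEXn; case: ltnP => h.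
  by case: eqP => // e; move: h; rewrite e ltnNge leq_addr.
by rewrite -(eqn_add2l i) subnKC.
Qed.

Lemma Xn0 : 'q^0 = 1 :> fps R. Proof. by []. Qed.

Lemma expXn i n : 'q^i ^+ n = 'q^(i * n)%N :> fps R.
Proof. by elim: n => [|n IHn]; rewrite ?muln0 // exprS IHn mulXn mulnS. Qed.

Lemma eqq_Xn k : eqq k 'q^k (0 : fps R).
Proof. by move=> n lt; rewrite fpsEXn ltn_eqF. Qed.

End Convergence.

(** * The substitution of q^k for q *)

(* The substitution q -> q^k; for k = 0 it is evaluation at q = 0, which keeps
   it a ring morphism for every k. It is locked because unfolding it in failed
   unifications diverges. *)
HB.lock Definition dil (R : comUnitRingType) (k : nat) (x : fps R) : fps R :=
  FPS (fun n => if (k %| n)%N then x (n %/ k)%N else 0).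

Section Dilation.
Variable R : comUnitRingType.
Implicit Types (x y z : fps R) (u v : nat -> fps R) (k m n N : nat).

Lemma dil_coef k x n :
  dil k x n = if (k %| n)%N then x (n %/ k)%N else 0.
Proof. by rewrite dil.unlock. Qed.

Lemma dilE k x n : (0 < k)%N -> dil k x (k * n)%N = x n.
Proof. by move=> k0; rewrite dil_coef dvdn_mulr // mulKn. Qed.

Lemma dil_out k x n : ~~ (k %| n)%N -> dil k x n = 0.
Proof. by rewrite dil_coef => /negPf ->. Qed.

Lemma sum_dvdn (V : nmodType) k m (F : nat -> V) : (0 < k)%N ->
  \sum_(i < (k * m).+1 | (k %| i)%N) F i = \sum_(i < m.+1) F (k * i)%N.
Proof.
move=> k0.
transitivity (\sum_(i < (k * m).+1) if (k %| i)%N then F i else 0).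
  by rewrite big_mkcond.
elim: m => [|m IHm]; first by rewrite muln0 !big_ord_recl !big_ord0 dvdn0 muln0.
rewrite [RHS]big_ord_recr /= -IHm.
have -> : (k * m.+1).+1 = ((k * m).+1 + k)%N by rewrite mulnSr addSn.
rewrite big_split_ord /=; congr (_ + _).
case: k k0 {IHm} => // k _; rewrite big_ord_recr /= big1 ?add0r.
  by rewrite addSnnS -mulnSr dvdn_mulr.
move=> i _; rewrite addSnnS dvdn_addr ?dvdn_mulr // gtnNdvd //.
by rewrite ltnS ltn_ord.
Qed.

Lemma dilM k x y : dil k (x * y) = dil k x * dil k y.
Proof.
apply: fpsP => n; rewrite [RHS]fpsEM.
(* Degree 0 is treated apart to cover k = 0: for n > 0, divisibility of n by k forces k > 0. *)
have [->|n0] := eqVneq n 0%N.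
  by rewrite big_ord1 !dil_coef subn0 dvdn0 div0n fpsEM big_ord1 subn0.
under eq_bigr do rewrite !dil_coef.
rewrite dil_coef; case: ifPn => [/dvdnP [m nE]|kn]; last first.
  rewrite big1 // => i _; case: ifPn => ki; rewrite ?mul0r //.
  by rewrite dvdn_subl ?(negPf kn) ?mulr0 // -ltnS.
have k0 : (0 < k)%N by case: k nE n0 => // ->; rewrite muln0.
rewrite nE mulnC mulKn //.
transitivity
    (\sum_(i < (k * m).+1 | (k %| i)%N) x (i %/ k)%N * y (m - i %/ k)%N).
  rewrite (sum_dvdn m (fun i => x (i %/ k)%N * y (m - i %/ k)%N) k0).
  by apply: eq_bigr => i _; rewrite mulKn.
rewrite [LHS]big_mkcond; apply: eq_bigr => i _.
case: ifPn => [/dvdnP [j ->]|]; last by rewrite mul0r.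
by rewrite [(j * k)%N]mulnC -mulnBr !mulKn // dvdn_mulr.
Qed.

Fact dil_is_zmod k : zmod_morphism (@dil R k).
Proof.
move=> x y; apply: fpsP => n; rewrite fpsED fpsEN !dil_coef.
by case: ifP => // _; rewrite subr0.
Qed.
HB.instance Definition _ k :=
  GRing.isZmodMorphism.Build (fps R) (fps R) (@dil R k) (dil_is_zmod k).

Lemma dil1 k : dil k (1 : fps R) = 1.
Proof.
apply: fpsP => n; rewrite dil_coef !fpsE1.
case: ifPn => [/dvdnP [m ->]|]; last by case: n => //; rewrite dvdn0.
case: k => [|k]; first by rewrite muln0.
by rewrite mulnK // muln_eq0 orbF.
Qed.

Fact dil_is_monoid k : monoid_morphism (@dil R k).
Proof. by split; [exact: dil1 | exact: dilM]. Qed.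
HB.instance Definition _ k :=
  GRing.isMonoidMorphism.Build (fps R) (fps R) (@dil R k) (dil_is_monoid k).

Lemma dil_dil k l x : (0 < k)%N -> dil k (dil l x) = dil (k * l) x.
Proof.
move=> k0; apply: fpsP => n; rewrite !dil_coef.
case: (boolP (k %| n)%N) => [/dvdnP [m ->]|kn].
  by rewrite mulnK // [(m * k)%N]mulnC dvdn_pmul2l // divnMl.
case: ifP => // /dvdnP [m nE]; case/negP: kn.
by rewrite nE dvdn_mull // dvdn_mulr.
Qed.

Lemma dil_Xn k i : (0 < k)%N -> dil k ('q^i : fps R) = 'q^(k * i)%N.
Proof.
move=> k0; apply: fpsP => n; rewrite dil_coef !fpsEXn.
case: (boolP (k %| n)%N) => [/dvdnP [m ->]|kn].
  by rewrite mulnK // mulnC eqn_pmul2l.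
by case: eqP => // nE; rewrite nE dvdn_mulr in kn.
Qed.

Lemma eqq_dil k N x y : (0 < k)%N -> eqq N x y -> eqq N (dil k x) (dil k y).
Proof.
move=> k0 h n lt; rewrite !dil_coef; case: ifP => // _; apply: h.
exact: leq_ltn_trans (leq_div _ _) lt.
Qed.

Lemma dil_infsum k u : (0 < k)%N -> (forall i, eqq i (u i) 0) ->
  dil k (infsum u) = infsum (fun i => dil k (u i)).
Proof.
move=> k0 h; apply: (@tends_unique _ (fun N => \sum_(i < N) dil k (u i))).
  by move=> N; rewrite -rmorph_sum; apply/eqq_dil/tends_infsum.
by apply: tends_infsum => i; rewrite -(rmorph0 (@dil R k)); apply: eqq_dil.
Qed.

Lemma dil_infprod k u : (0 < k)%N -> (forall i, eqq i (u i) 1) ->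
  dil k (infprod u) = infprod (fun i => dil k (u i)).
Proof.
move=> k0 h; apply: (@tends_unique _ (fun N => \prod_(i < N) dil k (u i))).
  by move=> N; rewrite -rmorph_prod; apply/eqq_dil/tends_infprod.
by apply: tends_infprod => i; rewrite -(rmorph1 (@dil R k)); apply: eqq_dil.
Qed.

End Dilation.

(** * The finite Jacobi triple product *)

Section QBinomial.
Variables (R : comUnitRingType) (Q : fps R).
Hypothesis Q0 : eqq 1 Q 0.
Implicit Types k m n N j : nat.

Definition qfact n : fps R := \prod_(k < n) (1 - Q ^+ k.+1).

(** The Gaussian binomial coefficient; the quotient makes sense because Q has no constant term,
    which makes every [qfact] a unit. *)
Definition qbin n k : fps R :=
  if (k <= n)%N then qfact n / (qfact k * qfact (n - k)) else 0.

Lemma eqq_1BX n : eqq n (1 - Q ^+ n) 1.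
Proof.
by rewrite -[X in eqq _ _ X]subr0; apply: eqqD => //; apply/eqqN/eqqX0.
Qed.

Lemma qfactS n : qfact n.+1 = qfact n * (1 - Q ^+ n.+1).
Proof. by rewrite /qfact big_ord_recr. Qed.

Lemma unit_1BX n : 1 - Q ^+ n.+1 \is a GRing.unit.
Proof.
apply: (@eqq_unit _ n.+1 1) => //; last exact: unitr1.
exact/eqq_sym/eqq_1BX.
Qed.

Lemma qfact_unit n : qfact n \is a GRing.unit.
Proof. by apply: rpred_prod => i _; apply: unit_1BX. Qed.

Lemma qbin0 n : qbin n 0 = 1.
Proof. by rewrite /qbin subn0 /qfact big_ord0 mul1r divrr ?qfact_unit. Qed.

Lemma qbinn n : qbin n n = 1.
Proof. by rewrite /qbin leqnn subnn /qfact big_ord0 mulr1 divrr ?qfact_unit. Qed.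

Lemma qbin_gt n k : (n < k)%N -> qbin n k = 0.
Proof. by rewrite /qbin ltnNge => /negPf ->. Qed.

Lemma qbin_sub n k : (k <= n)%N -> qbin n (n - k) = qbin n k.
Proof. by move=> le; rewrite /qbin leq_subr le subKn // [_ * qfact k]mulrC. Qed.

(** Over a common denominator this is 1 - Q^(m+1) = (1 - Q^(m-j)) + Q^(m-j) (1 - Q^(j+1)). *)
Lemma qbinS m j : (j <= m)%N ->
  qbin m.+1 j.+1 = qbin m j.+1 + Q ^+ (m - j) * qbin m j.
Proof.
rewrite leq_eqVlt => /orP [/eqP ->|ltjm].
  by rewrite !qbinn qbin_gt // subnn add0r mulr1.
rewrite /qbin ltnS ltjm (ltnW ltjm) subSS.
have -> : (m - j = (m - j.+1).+1)%N by rewrite subnSK.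
set d := (m - j.+1)%N; have mE : m.+1 = (j.+1 + d.+1)%N by rewrite /d; lia.
rewrite [qfact m.+1]qfactS mE exprD !invrM ?qfact_unit //.
have qfactV k : (qfact k)^-1 = (1 - Q ^+ k.+1) * (qfact k.+1)^-1.
  by rewrite qfactS invrM ?qfact_unit ?unit_1BX // mulVKr ?unit_1BX.
rewrite (qfactV d) (qfactV j).
ring.
Qed.

(** The mirror image of [qbinS] under the symmetry [qbin_sub]. *)
Lemma qbinS' m j : (j <= m)%N ->
  qbin m.+1 j.+1 = Q ^+ j.+1 * qbin m j.+1 + qbin m j.
Proof.
rewrite leq_eqVlt => /orP [/eqP ->|ltjm].
  by rewrite !qbinn qbin_gt // mulr0 add0r.
rewrite -[LHS]qbin_sub ?ltnS 1?ltnW // subSS -(subnSK ltjm) qbinS; last first.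
  by rewrite leq_subr.
rewrite subKn // subnSK // qbin_sub 1?ltnW // qbin_sub //; exact: addrC.
Qed.

Variables a b : fps R.
Hypothesis abQ : a * b = Q.

Lemma bin2S n : 'C(n.+1, 2) = ('C(n, 2) + n)%N.
Proof. by rewrite binS bin1. Qed.

(* a^(n(n+1)/2) b^(n(n-1)/2) for the integer n = j - N: one of the truncated
   differences j - N and N - j always vanishes. *)
Definition jterm N j : fps R :=
  a ^+ ('C((j - N).+1, 2) + 'C(N - j, 2)) *
  b ^+ ('C(j - N, 2) + 'C((N - j).+1, 2)).

Lemma jtermSS N j : jterm N.+1 j.+1 = jterm N j.
Proof. by rewrite /jterm !subSS. Qed.

(** With n = j - N, the ratio of the terms of index n + 1 and n is a Q^n. The truncated subtractions
    force a split by the sign of n. *)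
Lemma jterm_step M N j : (j <= M + N)%N ->
  a * Q ^+ M * jterm N j = Q ^+ (M + N - j) * jterm N j.+1.
Proof.
rewrite /jterm => lej; have [leNj|ltjN] := leqP N j.
  have -> : (N - j = 0)%N by lia.
  have -> : (N - j.+1 = 0)%N by lia.
  rewrite subSn //; set n := (j - N)%N.
  have -> : M = ((M + N - j) + n)%N by rewrite /n; lia.
  have -> : (M + N - j + n + N - j = M + N - j)%N by rewrite /n; lia.
  rewrite -abQ !bin2S ?bin0n ?addn0 ?add0n !exprD !exprMn ?expr0 ?exprS; ring.
have -> : (j - N = 0)%N by lia.
have -> : (j.+1 - N = 0)%N by lia.
rewrite -(subnSK ltjN); set n := (N - j.+1)%N.
have -> : (M + N - j = M + n.+1)%N by rewrite /n; lia.
rewrite -abQ !bin2S ?bin0n ?addn0 ?add0n !exprD !exprMn ?expr0 !exprS; ring.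
Qed.

(** Raising N lowers n = j - N by one, and the ratio a Q^(n-1) turns b Q^N into Q^(N+n) = Q^j. *)
Lemma jterm_step' N j : b * Q ^+ N * jterm N j = Q ^+ j * jterm N.+1 j.
Proof.
rewrite /jterm; have [leNj|ltjN] := leqP N.+1 j.
  have -> : (N - j = 0)%N by lia.
  have -> : (N.+1 - j = 0)%N by lia.
  rewrite -(subnSK leNj); set n := (j - N.+1)%N.
  have -> : j = (N + n.+1)%N by rewrite /n; lia.
  rewrite -abQ !bin2S ?bin0n ?addn0 ?add0n !exprD !exprMn ?expr0 !exprS; ring.
have -> : (j - N = 0)%N by lia.
have -> : (j - N.+1 = 0)%N by lia.
rewrite subSn //; set n := (N - j)%N.
have -> : N = (j + n)%N by rewrite /n; lia.
rewrite -abQ !bin2S ?bin0n ?addn0 ?add0n !exprD !exprMn ?expr0 ?exprS; ring.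
Qed.

Lemma jsum_stepr M N :
  \sum_(j < (M.+1 + N).+1) qbin (M.+1 + N) j * jterm N j =
  (1 + a * Q ^+ M) * \sum_(j < (M + N).+1) qbin (M + N) j * jterm N j.
Proof.
rewrite mulrDl mul1r mulr_sumr addSn.
have -> : \sum_(j < (M + N).+1) qbin (M + N) j * jterm N j =
   \sum_(j < (M + N).+2) qbin (M + N) j * jterm N j.
  by rewrite [RHS]big_ord_recr /= qbin_gt // mul0r addr0.
rewrite !(big_ord_recl (M + N).+1) !qbin0 -!addrA; congr (_ + _).
rewrite -big_split; apply: eq_bigr => j _ /=; rewrite /bump add1n.
have lej : (j <= M + N)%N by rewrite -ltnS.
rewrite qbinS // [_ * (qbin _ _ * jterm _ j)]mulrCA jterm_step //; ring.
Qed.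

Lemma jsum_stepl M N :
  \sum_(j < (M + N.+1).+1) qbin (M + N.+1) j * jterm N.+1 j =
  (1 + b * Q ^+ N) * \sum_(j < (M + N).+1) qbin (M + N) j * jterm N j.
Proof.
rewrite mulrDl mul1r mulr_sumr addnS.
have -> : \sum_(j < (M + N).+1) b * Q ^+ N * (qbin (M + N) j * jterm N j) =
   \sum_(j < (M + N).+2) Q ^+ j * qbin (M + N) j * jterm N.+1 j.
  rewrite [RHS]big_ord_recr /= qbin_gt // mulr0 mul0r addr0.
  by apply: eq_bigr => j _; rewrite mulrCA jterm_step'; ring.
rewrite !(big_ord_recl (M + N).+1) !qbin0 expr0 !mul1r addrCA.
congr (_ + _); rewrite -big_split; apply: eq_bigr => j _ /=.
have lej : (j <= M + N)%N by rewrite -ltnS.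
rewrite /bump add1n qbinS' // jtermSS; ring.
Qed.

(** One factor at a time: a new factor in a raises the index and calls for [qbinS], a new factor in
    b moves its origin and calls for [qbinS']. *)
Lemma finite_jtp M N :
  \prod_(k < M) (1 + a * Q ^+ k) * \prod_(k < N) (1 + b * Q ^+ k) =
  \sum_(j < (M + N).+1) qbin (M + N) j * jterm N j.
Proof.
elim: M => [|M IHM]; last first.
  by rewrite jsum_stepr -IHM big_ord_recr /=; ring.
elim: N => [|N IHN].
  by rewrite !big_ord0 big_ord1 qbin0 /jterm /= !expr0 !mulr1.
by rewrite jsum_stepl -IHN [in LHS]big_ord_recr /=; ring.
Qed.

End QBinomial.

(** * The Jacobi triple product *)

Section JacobiTripleProduct.
Variable R : comUnitRingType.
Implicit Types (a b x y : fps R).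

Lemma eqq_sub0 N x y : eqq N (x - y) 0 -> eqq N x y.
Proof. by move=> h; rewrite -[x](subrK y) -[y in eqq _ _ y]add0r; apply: eqqD. Qed.

Definition theta_term a b k :=
  a ^+ 'C(k.+1, 2) * b ^+ 'C(k, 2) + a ^+ 'C(k.+1, 2) * b ^+ 'C(k.+2, 2).

(* Ramanujan's f(a, b) = \sum_(n in Z) a^(n(n+1)/2) b^(n(n-1)/2), with the
   indices k and - k - 1 taken together. *)
Definition theta a b : fps R := infsum (theta_term a b).

Variables a b : fps R.
Hypotheses (a0 : eqq 1 a 0) (b0 : eqq 1 b 0).

Lemma eqq_XX m n N : (N <= m + n)%N -> eqq N (a ^+ m * b ^+ n) 0.
Proof. by move=> /eqqW; apply; apply: eqqM0; apply: eqqX0. Qed.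

Lemma leq_bin2S k : (k <= 'C(k.+1, 2))%N.
Proof. by rewrite binS bin1 leq_addl. Qed.

Lemma eqq_theta_term k : eqq k (theta_term a b k) 0.
Proof.
rewrite -[0](addr0 0); apply: eqqD; apply: eqq_XX;
  exact: leq_trans (leq_bin2S k) (leq_addr _ _).
Qed.

Let Q := a * b.
Let Q0 : eqq 1 Q 0. Proof. exact: eqq0_M. Qed.
Let E := infprod (fun k => 1 - Q ^+ k.+1).

Let eqq_E j : eqq j.+1 E (qfact Q j).
Proof.
have /(_ j.+1) := tends_infprod (fun k => eqqW (leqnSn k) (@eqq_1BX _ _ Q0 k.+1)).
move=> /eqq_trans; apply; rewrite big_ord_recr /= -[X in eqq _ _ X]mulr1.
by apply: eqqM => //; apply: eqq_1BX.
Qed.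

(** To this order all three q-factorials in the Gaussian binomial agree with [E], so the product
    reduces to E E / (E E). *)
Let eqq_qbin m j : (j <= m)%N -> eqq (minn j (m - j)).+1 (E * qbin Q m j) 1.
Proof.
move=> lejm; have U := qfact_unit Q0.
apply: (@eqq_cancel _ _ (qfact Q j * qfact Q (m - j))); first by rewrite unitrM !U.
rewrite /qbin lejm mulr1 mulrCA [_ * (_ / _)]mulrC divrK ?unitrM ?U //.
apply: eqqM.
  by apply: (eqqW _ (@eqq_E j)); rewrite ltnS geq_minl.
apply: (@eqq_trans _ _ _ E); last first.
  by apply: (eqqW _ (@eqq_E (m - j))); rewrite ltnS geq_minr.
apply/eqq_sym/(eqqW _ (@eqq_E m)); rewrite ltnS; exact: leq_trans (geq_minl _ _) _.
Qed.

Let eqq_jterm N j : eqq (maxn (j - N) (N - j)) (jterm a b N j) 0.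
Proof.
apply: eqq_XX; rewrite geq_max; apply/andP; split.
  by apply: leq_trans (leq_bin2S _) _; rewrite -addnA leq_addr.
by apply: leq_trans (leq_bin2S _) _; rewrite addnA leq_addl.
Qed.

(** The left side runs over -N <= n <= N, while N paired terms of [theta] cover -N <= n < N; the
    term n = N is left over. *)
Let jterm_sum N :
  \sum_(j < (N + N).+1) jterm a b N j =
  \sum_(k < N) theta_term a b k + jterm a b N (N + N).
Proof.
rewrite -addnS big_split_ord /= [X in _ + X]big_ord_recr /= addrA.
congr (_ + _); rewrite (reindex_inj rev_ord_inj) /= addrC -big_split.
apply: eq_bigr => k _ /=; rewrite /theta_term /jterm.
have lt := ltn_ord k.
have -> : (N + k - N = k)%N by lia.
have -> : (N - (N + k) = 0)%N by lia.
have -> : (N - k.+1 - N = 0)%N by lia.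
have -> : (N - (N - k.+1) = k.+1)%N by lia.
by rewrite (_ : 'C(1, 2) = 0%N) // (_ : 'C(0, 2) = 0%N) // !addn0 !add0n.
Qed.

Lemma jacobi_triple_product :
  theta a b = infprod (fun k => (1 + a * (a * b) ^+ k) * (1 + b * (a * b) ^+ k)
                                * (1 - (a * b) ^+ k.+1)).
Proof.
have hQ k : eqq k (1 - Q ^+ k.+1) 1 := eqqW (leqnSn k) (@eqq_1BX _ _ Q0 k.+1).
have hc c : eqq 1 c 0 -> forall k, eqq k (1 + c * Q ^+ k) 1.
  move=> c0 k; rewrite -[X in eqq _ _ X]addr0; apply: eqqD => //.
  by rewrite mulrC; apply/eqq0_M/eqqX0.
rewrite -/Q !infprodM; try by [|apply: hc|apply: hQ]; last first.
  by move=> k; rewrite -[X in eqq _ _ X]mulr1; apply: eqqM; apply: hc.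
rewrite -/E; apply: (tends_unique (tends_infsum eqq_theta_term)) => N.
apply: (@eqq_trans _ _ _
  (\prod_(k < N) (1 + a * Q ^+ k) * \prod_(k < N) (1 + b * Q ^+ k) * E)).
  apply: eqqM => //; apply: eqqM; exact: tends_infprod (hc _ _) _.
rewrite (finite_jtp Q0 (erefl Q)) mulr_suml.
apply: (@eqq_trans _ _ _ (\sum_(j < (N + N).+1) jterm a b N j)).
  apply: eqq_sum => j _; apply: eqq_sub0.
  have -> : qbin Q (N + N) j * jterm a b N j * E - jterm a b N j =
    (E * qbin Q (N + N) j - 1) * jterm a b N j by ring.
  have lej : (j <= N + N)%N by rewrite -ltnS.
  (* Since min(j, 2N - j) = N - |j - N|, the precision of the binomial and the order of the term add
     up to N + 1. *)
  apply: (@eqqW _ _ ((minn j (N + N - j)).+1 + maxn (j - N) (N - j))); first lia.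
  apply: eqqM0 => //; rewrite -(subrr 1); apply: eqqD => //; exact: eqq_qbin.
rewrite jterm_sum -[X in eqq _ _ X]addr0; apply: eqqD => //.
by apply: (eqqW _ (@eqq_jterm _ _)); rewrite addnK leq_maxl.
Qed.

End JacobiTripleProduct.

(** * Product formulas for theta series *)

Section QPochhammer.
Variable R : comUnitRingType.
Implicit Types (e : fps R) (i j k m d : nat).

(* (- e q^i; q^d)_oo *)
Definition qpoch e i d : fps R := infprod (fun k => 1 + e * 'q^(i + d * k)%N).

Lemma eqq_qpoch e i d k : (0 < d)%N -> eqq k (1 + e * 'q^(i + d * k)%N) 1.
Proof.
move=> d0; rewrite -[X in eqq _ _ X]addr0; apply: eqqD => //.
rewrite mulrC; apply/eqq0_M/(eqqW _ (@eqq_Xn R _)).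
by rewrite (leq_trans (leq_pmull k d0)) // leq_addl.
Qed.

Lemma infprod_prod m (u : nat -> nat -> fps R) :
  (forall r k, eqq k (u r k) 1) ->
  infprod (fun k => \prod_(r < m) u r k) = \prod_(r < m) infprod (u r).
Proof.
move=> h; elim: m => [|m IHm].
  rewrite big_ord0; apply: fpsP => n /=.
  by under eq_bigr do rewrite big_ord0; rewrite big1.
rewrite big_ord_recr /= -IHm -infprodM //; last first.
  move=> k; apply: (@eqq_trans _ _ _ (\prod_(r < m) 1)); last by rewrite big1.
  by apply: eqq_prod => r _.
by apply: eq_infprod => k; rewrite big_ord_recr.
Qed.

(** Splitting k modulo m brings products to a common base q^(d m), where they can be compared factor
    by factor. *)
Lemma qpoch_split m e i d : (0 < m)%N -> (0 < d)%N ->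
  qpoch e i d = \prod_(r < m) qpoch e (i + d * r) (d * m).
Proof.
move=> m0 d0; rewrite /qpoch (infprod_block m0) => [|k]; last exact: eqq_qpoch.
rewrite -(infprod_prod _ (u := fun r k => 1 + e * 'q^(i + d * r + d * m * k)%N)).
  apply: eq_infprod => k; apply: eq_bigr => r _.
  by rewrite mulnDr mulnA addnA addnAC.
by move=> r k; apply: eqq_qpoch; rewrite muln_gt0 d0.
Qed.

(** Factorwise (1 + x) (1 - x) = 1 - x^2. *)
Lemma qpochNM i d : (0 < d)%N ->
  qpoch 1 i d * qpoch (-1) i d = qpoch (-1) (2 * i) (2 * d).
Proof.
move=> d0; rewrite /qpoch -infprodM => [|k|k]; try exact: eqq_qpoch.
apply: eq_infprod => k.
have -> : (2 * i + 2 * d * k = (i + d * k) + (i + d * k))%N by lia.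
rewrite -(mulXn _ (i + d * k)); ring.
Qed.

(** The triple product with a b = q^(i+j), the signs cancelling because e^2 = 1. *)
Lemma theta_qpoch e i j : e ^+ 2 = 1 -> (0 < i)%N -> (0 < j)%N ->
  theta (e * 'q^i) (e * 'q^j) =
  qpoch e i (i + j) * qpoch e j (i + j) * qpoch (-1) (i + j) (i + j).
Proof.
move=> e2 i0 j0; have ij0 : (0 < i + j)%N by rewrite addn_gt0 i0.
have X0 k : (0 < k)%N -> eqq 1 (e * 'q^k) 0.
  by move=> k0; rewrite mulrC; apply/eqq0_M/(eqqW k0)/eqq_Xn.
rewrite jacobi_triple_product; try exact: X0.
rewrite /qpoch -!infprodM => [|k|k|k|k]; try exact: eqq_qpoch.
  apply: eq_infprod => k.
  have -> : e * 'q^i * (e * 'q^j) = 'q^(i + j)%N.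
    by rewrite mulrACA -expr2 e2 mul1r mulXn.
  by rewrite !expXn mulnS -!mulXn; ring.
by rewrite -[X in eqq _ _ X]mulr1; apply: eqqM; exact: eqq_qpoch.
Qed.

End QPochhammer.

Lemma eulerf_qpoch j : (0 < j)%N -> eulerf j = qpoch (-1) j j.
Proof.
move=> j0; apply: fpsP => n; rewrite -(eulerf_stable j0 (leqnSn n)) /=.
rewrite big_add1 /= big_mkord; congr (coefs _ n).
by apply: eq_bigr => k _; rewrite mulN1r mulnS.
Qed.

Lemma dil_qpoch (R : comUnitRingType) (e : fps R) k i d :
  (0 < k)%N -> (0 < d)%N -> dil k (qpoch e i d) = qpoch (dil k e) (k * i) (k * d).
Proof.
move=> k0 d0; rewrite /qpoch dil_infprod // => [|n]; last exact: eqq_qpoch.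
apply: eq_infprod => n.
by rewrite rmorphD rmorph1 rmorphM /= dil_Xn // mulnDr mulnA.
Qed.

Lemma dil_eulerf k j : (0 < k)%N -> (0 < j)%N -> dil k (eulerf j) = eulerf (k * j).
Proof.
move=> k0 j0; rewrite !eulerf_qpoch ?muln_gt0 ?k0 // dil_qpoch //.
by rewrite rmorphN rmorph1.
Qed.

(** * Product identities for the four theta series *)

Local Notation f := eulerf.
(** In Ramanujan's notation [phi] is phi(-q) and [psi] is psi(q). The form f(q^3, q) of psi, unlike
    f(q, 1) / 2, has arguments without constant term, as the triple product requires. *)
HB.lock Definition phi : fps int := theta (- 'q^1) (- 'q^1).
HB.lock Definition psi : fps int := theta 'q^3 'q^1.
HB.lock Definition thA : fps int := theta 'q^2 'q^1.
HB.lock Definition thB : fps int := theta (- 'q^5) (- 'q^1).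

(** Both sides equal (q; q^2)^2 (q^2; q^2)^2. *)
Lemma f1_sqr : f 1 ^+ 2 = f 2 * phi.
Proof.
rewrite phi.unlock -mulN1r theta_qpoch // ?sqrrN ?expr1n //
  !eulerf_qpoch //.
by rewrite (@qpoch_split _ 2 _ 1 1) // !big_ord_recl big_ord0 /=; ring.
Qed.

(** Here psi = (-q; q^2) (q^4; q^4), and multiplying by (q; q^2) from f_1 gives (q^2; q^4) (q^4;
    q^4) = f_2. *)
Lemma f2_sqr : f 2 ^+ 2 = f 1 * psi.
Proof.
rewrite psi.unlock -['q^1]mul1r -['q^3]mul1r theta_qpoch // ?expr1n //
  !eulerf_qpoch //.
have E1 : qpoch (-1) 1 1 = qpoch (-1) 1 2 * qpoch (-1) 2 2 :> fps int.
  by rewrite (@qpoch_split _ 2) // !big_ord_recl big_ord0 mulr1.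
have E2 : qpoch 1 1 2 = qpoch 1 3 4 * qpoch 1 1 4 :> fps int.
  by rewrite (@qpoch_split _ 2) // !big_ord_recl big_ord0 mulr1 mulrC.
have E3 : qpoch (-1) 2 2 = qpoch (-1) 2 4 * qpoch (-1) 4 4 :> fps int.
  by rewrite (@qpoch_split _ 2) // !big_ord_recl big_ord0 mulr1.
by rewrite -E2 E1 E3 -[qpoch _ 2 4](@qpochNM _ 1 2) //; ring.
Qed.

Lemma f2_phi3 : f 2 * dil 3 phi = f 1 * thA.
Proof.
(* The factor f_6 turns phi(-q^3) into f_3^2, by [f1_sqr] at q^3. *)
apply: (mulIr (eulerf_unit 6)).
have -> : f 2 * dil 3 phi * f 6 = f 2 * f 3 ^+ 2.
  by rewrite -[f 3](@dil_eulerf 3 1) // -rmorphXn f1_sqr rmorphM /=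
    dil_eulerf //; ring.
rewrite thA.unlock -['q^1]mul1r -['q^2]mul1r theta_qpoch // ?expr1n //
  !eulerf_qpoch //.
have -> : qpoch (-1) 1 1 =
    qpoch (-1) 1 3 * qpoch (-1) 2 3 * qpoch (-1) 3 3 :> fps int.
  by rewrite (@qpoch_split _ 3) // !big_ord_recl big_ord0 mulr1 mulrA.
have -> : qpoch (-1) 2 2 =
    qpoch (-1) 2 6 * qpoch (-1) 4 6 * qpoch (-1) 6 6 :> fps int.
  by rewrite (@qpoch_split _ 3) // !big_ord_recl big_ord0 mulr1 mulrA.
by rewrite -[qpoch _ 2 6](@qpochNM _ 1 3) // -[qpoch _ 4 6](@qpochNM _ 2 3) //; ring.
Qed.

Lemma f2_thB : f 2 * thB = f 1 * dil 3 psi.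
Proof.
(* The factor f_3 turns psi(q^3) into f_6^2, by [f2_sqr] at q^3; the remaining products are compared
   modulo 6. *)
apply: (mulIr (eulerf_unit 3)).
have -> : f 1 * dil 3 psi * f 3 = f 1 * f 6 ^+ 2.
  by rewrite -[f 6](@dil_eulerf 3 2) // -rmorphXn f2_sqr rmorphM /=
    dil_eulerf //; ring.
rewrite thB.unlock -(mulN1r 'q^5) -(mulN1r 'q^1) theta_qpoch // ?sqrrN ?expr1n //
  !eulerf_qpoch //.
have -> : qpoch (-1) 1 1 =
    qpoch (-1) 1 6 * qpoch (-1) 2 6 * qpoch (-1) 3 6 *
    qpoch (-1) 4 6 * qpoch (-1) 5 6 * qpoch (-1) 6 6 :> fps int.
  by rewrite (@qpoch_split _ 6) // !big_ord_recl big_ord0 mulr1 !mulrA.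
have -> : qpoch (-1) 2 2 =
    qpoch (-1) 2 6 * qpoch (-1) 4 6 * qpoch (-1) 6 6 :> fps int.
  by rewrite (@qpoch_split _ 3) // !big_ord_recl big_ord0 mulr1 mulrA.
have -> : qpoch (-1) 3 3 = qpoch (-1) 3 6 * qpoch (-1) 6 6 :> fps int.
  by rewrite (@qpoch_split _ 2) // !big_ord_recl big_ord0 mulr1.
by rewrite (_ : (5 + 1)%N = 6) //; ring.
Qed.

(** * Dissections modulo 3 *)

(** Makes exponents with binomials linear in k and k * k, within reach of [lia]. *)
Lemma bin2_sqr k : (2 * 'C(k, 2) + k = k * k)%N.
Proof. by elim: k => [//|k IHk]; rewrite bin2S; lia. Qed.

Lemma eqq1_Xn (R : comUnitRingType) k : (0 < k)%N -> eqq 1 'q^k (0 : fps R).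
Proof. by move=> /eqqW; apply; apply: eqq_Xn. Qed.

Lemma eqq1_NXn (R : comUnitRingType) k : (0 < k)%N -> eqq 1 (- 'q^k) (0 : fps R).
Proof. by move=> k0; rewrite -[0]oppr0; apply/eqqN/eqq1_Xn. Qed.

Lemma expXnM (R : comUnitRingType) i j m n :
  'q^i ^+ m * 'q^j ^+ n = 'q^(i * m + j * n)%N :> fps R.
Proof. by rewrite !expXn mulXn. Qed.

Lemma expNXnM (R : comUnitRingType) i j m n :
  (- 'q^i) ^+ m * (- 'q^j) ^+ n = (-1) ^+ (m + n) * 'q^(i * m + j * n)%N :> fps R.
Proof.
by rewrite [(- 'q^i) ^+ _]exprNn [(- 'q^j) ^+ _]exprNn mulrACA -exprD expXnM.
Qed.

Definition psi_term k : fps int := 'q^('C(k.+1, 2)).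

Lemma eqq_psi_term k : eqq k (psi_term k) 0.
Proof. by apply/eqqW/eqq_Xn; apply: leq_bin2S. Qed.

(** The k-th pair of theta terms gives the triangular numbers of index 2k and 2k + 1. *)
Lemma psiE : psi = infsum psi_term.
Proof.
rewrite psi.unlock (@infsum_block _ 2) => [|//|]; last exact: eqq_psi_term.
apply: eq_infsum => k; rewrite !big_ord_recl big_ord0 addr0 /bump /=.
rewrite /theta_term !expXnM /psi_term.
by congr ('q^_ + 'q^_); have := bin2_sqr k; have := bin2_sqr (2 * k);
  rewrite ?(addn0, addn1) !bin2S; lia.
Qed.

(** Write T_i for the triangular number i (i + 1) / 2. Then T_(3k+1) = 9 T_k + 1, while T_(3k) and
    T_(3k+2) are 3 times the two exponents in the k-th pair of [thA]. *)
Lemma psi_dissect : psi = dil 3 thA + 'q^1 * dil 9 psi.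
Proof.
rewrite {2}psiE thA.unlock !dil_infsum //; try exact: eqq_psi_term; last first.
  by apply: eqq_theta_term; apply: eqq1_Xn.
rewrite -infsumZ => [|k]; last first.
  by rewrite -(rmorph0 (@dil int 9)); apply: eqq_dil => //; apply: eqq_psi_term.
rewrite -infsumD psiE (@infsum_block _ 3) => [|//|]; last exact: eqq_psi_term.
apply: eq_infsum => k; rewrite !big_ord_recl big_ord0 addr0 /bump /=.
rewrite /theta_term !expXnM /psi_term rmorphD /= !dil_Xn // mulXn addrA addrAC.
by congr ('q^_ + 'q^_ + 'q^_); have := bin2_sqr k; have := bin2_sqr (3 * k);
  rewrite ?(addn0, addn1, addn2) !bin2S; lia.
Qed.

Definition phi_term k : fps int := (-1) ^+ k * 'q^(k * k)%N.

Lemma eqq_phi_term k : eqq k (phi_term k) 0.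
Proof.
rewrite /phi_term mulrC; apply/eqq0_M/eqqW/eqq_Xn.
by case: k => // k; apply: leq_pmull.
Qed.

Lemma eqq_phi_termS k : eqq k (phi_term k.+1) 0.
Proof. exact: eqqW (leqnSn k) (@eqq_phi_term k.+1). Qed.

Lemma sign_sqr k : (-1) ^+ (k * k)%N = (-1) ^+ k :> fps int.
Proof. by rewrite -signr_odd oddM andbb signr_odd. Qed.

(** The k-th pair holds the squares of k and k + 1, so every positive square occurs twice and 0
    once. *)
Lemma phiE : phi = 1 + 2 * infsum (fun k => phi_term k.+1).
Proof.
rewrite phi.unlock /theta (eq_infsum (v := fun k => phi_term k + phi_term k.+1)).
  rewrite infsumD infsum_recl => [|k]; last exact: eqq_phi_term.
  by rewrite /phi_term expr0 mul1r Xn0; ring.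
move=> k; rewrite /theta_term !expNXnM !mul1n.
have -> : ('C(k.+1, 2) + 'C(k, 2) = k * k)%N.
  by have := bin2_sqr k; rewrite bin2S; lia.
have -> : ('C(k.+1, 2) + 'C(k.+2, 2) = k.+1 * k.+1)%N.
  by have := bin2_sqr k; rewrite !bin2S; lia.
by rewrite !sign_sqr.
Qed.

(** The squares of 3k + 1 and 3k + 2 are 1 plus 3 times the exponents in the k-th pair of [thB],
    with opposite sign; the squares of 3k + 3 form the series in q^9. *)
Lemma phi_dissect : phi = dil 9 phi - 2 * 'q^1 * dil 3 thB.
Proof.
rewrite {2}phiE thB.unlock rmorphD rmorph1 rmorphM rmorph_nat /= dil_infsum //;
  last exact: eqq_phi_termS.
rewrite [dil 3 _]dil_infsum //; last by apply: eqq_theta_term; apply: eqq1_NXn.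
rewrite -mulrA -['q^1 * _]infsumZ => [|k]; last first.
  rewrite -(rmorph0 (@dil int 3)); apply: eqq_dil => //.
  by apply: eqq_theta_term; apply: eqq1_NXn.
rewrite phiE -addrA -mulrBr; congr (1 + 2 * _); apply/eqP.
(* With the [thB] part moved to the left, it cancels two of the three squares in each block. *)
rewrite eq_sym subr_eq eq_sym; apply/eqP.
rewrite (@infsum_block _ 3 (fun k => phi_term k.+1)) //;
  last exact: eqq_phi_termS.
rewrite -infsumD.
apply: eq_infsum => k; rewrite !big_ord_recl big_ord0 addr0 /bump /=.
rewrite /theta_term !expNXnM.
have -> : ('C(k.+1, 2) + 'C(k, 2) = k * k)%N.
  by have := bin2_sqr k; rewrite bin2S; lia.
have -> : ('C(k.+1, 2) + 'C(k.+2, 2) = k.+1 * k.+1)%N.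
  by have := bin2_sqr k; rewrite !bin2S; lia.
rewrite !sign_sqr rmorphD !rmorphM !rmorphXn !rmorphN1 /= !dil_Xn //.
rewrite mulrDr ![_ * ((-1) ^+ _ * _)]mulrCA !mulXn.
have E1 : (1 + 3 * (5 * 'C(k.+1, 2) + 1 * 'C(k, 2)) =
           (3 * k + 0).+1 * (3 * k + 0).+1)%N.
  by have := bin2_sqr k; rewrite bin2S; lia.
have E2 : (1 + 3 * (5 * 'C(k.+1, 2) + 1 * 'C(k.+2, 2)) =
           (3 * k + 1).+1 * (3 * k + 1).+1)%N.
  by have := bin2_sqr k; rewrite !bin2S; lia.
have E3 : (9 * (k.+1 * k.+1) = (3 * k + 2).+1 * (3 * k + 2).+1)%N by lia.
have S r : (-1) ^+ (3 * k + r)%N = (-1) ^+ (k + r)%N :> fps int.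
  by rewrite -signr_odd oddD oddM /= -oddD signr_odd.
rewrite E1 E2 E3 /phi_term !exprS !S !exprD; ring.
Qed.

(** * Positivity *)

Section Positivity.
Implicit Types (x y : fps int) (i j k m n : nat).

Definition nonneg x := forall n, 0 <= x n.
Definition pos_below k x := nonneg x /\ forall n, (n < k)%N -> 0 < x n.
Definition positive x := forall n, 0 < x n.

Lemma positiveW x : positive x -> nonneg x.
Proof. by move=> h n; apply: ltW. Qed.

Lemma nonneg_Xn i : nonneg 'q^i.
Proof. by move=> n; rewrite fpsEXn. Qed.

Lemma nonnegD x y : nonneg x -> nonneg y -> nonneg (x + y).
Proof. by move=> h k n; rewrite fpsED addr_ge0. Qed.

Lemma nonneg_sum m (u : nat -> fps int) : (forall k, nonneg (u k)) ->
  nonneg (\sum_(k < m) u k).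
Proof. by move=> h; elim/big_ind: _ => [n|x y|k _]; [|exact: nonnegD|]. Qed.

Lemma nonnegM x y : nonneg x -> nonneg y -> nonneg (x * y).
Proof. by move=> h k n; rewrite fpsEM sumr_ge0 // => i _; apply: mulr_ge0. Qed.

Lemma nonnegX x n : nonneg x -> nonneg (x ^+ n).
Proof.
move=> h; elim: n => [|n IHn]; first exact: (nonneg_Xn 0).
by rewrite exprS; apply: nonnegM.
Qed.

Lemma nonneg_dil k x : nonneg x -> nonneg (dil k x).
Proof. by move=> h n; rewrite dil_coef; case: ifP. Qed.

Lemma coefM_gt0 x y i j : nonneg x -> nonneg y -> 0 < x i -> 0 < y j ->
  0 < (x * y) (i + j)%N.
Proof.
move=> hx hy xi yj; rewrite fpsEM.
have lt : (i < (i + j).+1)%N by rewrite ltnS leq_addr.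
rewrite (bigD1 (Ordinal lt)) //= addKn ltr_pwDl ?mulr_gt0 //.
by rewrite sumr_ge0 // => k _; apply: mulr_ge0.
Qed.

Lemma dil_coef0 k x : dil k x 0%N = x 0%N.
Proof. by rewrite dil_coef dvdn0 div0n. Qed.

Lemma coef0M_gt0 x y : nonneg x -> nonneg y -> 0 < x 0%N -> 0 < y 0%N ->
  0 < (x * y) 0%N.
Proof. exact: (@coefM_gt0 x y 0 0). Qed.

Lemma positiveM x y : positive x -> nonneg y -> 0 < y 0%N -> positive (x * y).
Proof.
by move=> hx hy y0 n; rewrite -[n]addn0 coefM_gt0 //; apply: positiveW.
Qed.

(** Euclidean division n = r + m s selects the coefficient of q^r in x and of q^s in y, whose
    product is positive. *)
Lemma pos_belowM m k x y : (0 < m)%N -> pos_below m x -> pos_below k y ->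
  pos_below (m * k) (x * dil m y).
Proof.
move=> m0 [x0 hx] [y0 hy]; split; first by apply/nonnegM/nonneg_dil.
move=> n lt; rewrite (divn_eq n m) addnC mulnC coefM_gt0 //.
- exact: nonneg_dil.
- by apply: hx; rewrite ltn_mod.
- by rewrite dilE // hy // ltn_divLR // mulnC.
Qed.

Lemma positive_dilM m x y : (0 < m)%N -> pos_below m x -> positive y ->
  positive (x * dil m y).
Proof.
move=> m0 hx hy n; have hy' : pos_below n.+1 y by split=> //; exact: positiveW.
by apply: (pos_belowM m0 hx hy').2; apply: leq_pmull.
Qed.

Lemma pos_below2_theta i : pos_below 2 (theta 'q^i 'q^1).
Proof.
have h k : nonneg (theta_term 'q^i 'q^1 k).
  by apply: nonnegD; apply: nonnegM; apply/nonnegX/nonneg_Xn.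
split=> [n|n lt]; first exact: (nonneg_sum n.+1 h).
(* The pair k = 0 is 1 + q for every i, which settles degrees 0 and 1. *)
rewrite /theta /= big_ord_recl fpsED ltr_pwDl //; last first.
  by apply: (nonneg_sum _ (u := fun k => theta_term _ _ k.+1)) => k.
rewrite /theta_term !expXnM fpsED !fpsEXn muln0.
by case: n lt => [|[]].
Qed.

Lemma positive_nonnegD x y : positive x -> nonneg y -> positive (x + y).
Proof. by move=> h k n; rewrite fpsED ltr_pwDl. Qed.

Lemma nonneg_mulrn x m : nonneg x -> nonneg (x *+ m).
Proof.
move=> h; elim: m => [|m IHm]; first by rewrite mulr0n => n.
by rewrite mulrS; apply: nonnegD.
Qed.

Lemma positive_mulrn x m : positive x -> positive (x *+ m.+1).
Proof.
move=> h; rewrite mulrS; apply: positive_nonnegD => //.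
exact/nonneg_mulrn/positiveW.
Qed.

Definition geom : fps int := FPS (fun=> 1).

Lemma geomE : (1 - 'q^1) * geom = 1.
Proof.
apply: fpsP => n; rewrite mulrBl mul1r fpsED fpsEN mulXnE fpsE1 /=.
by case: n => [|n] /=; rewrite ?subr0 ?subrr.
Qed.

(** Modulo q^(n+1) only the factors 1 - q, ..., 1 - q^(n+1) matter. Their inverses are geometric
    series: the first is positive in all degrees, the others are nonnegative with constant term
    1. *)
Lemma positive_f1V : positive (f 1)^-1.
Proof.
move=> n; pose P m : fps int := \prod_(k < m.+1) (1 - 'q^k.+1).
have [g gP] : exists2 g, P n * g = 1 & positive g.
  elim: n => [|n [g gP gpos]].
    by exists geom; rewrite // /P big_ord_recl big_ord0 mulr1 geomE.
  exists (g * dil n.+2 geom); last first.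
    by apply: positiveM => //; [exact: nonneg_dil | rewrite dil_coef0].
  rewrite /P big_ord_recr /= mulrACA -/(P n) gP mul1r.
  have := congr1 (dil n.+2) geomE.
  by rewrite rmorphM rmorphB !rmorph1 /= dil_Xn // muln1.
have PU : P n \is a GRing.unit by apply/unitrPr; exists g.
have -> : g = (P n)^-1 by rewrite -[g](mulKr PU) gP mulr1.
have fP : eqq n.+1 (f 1) (P n).
  move=> k lt; rewrite -(@eulerf_stable 1 k n.+1 isT (ltnW lt)).
  rewrite big_add1 /= big_mkord.
  by congr (coefs _ k); apply: eq_bigr => j _; rewrite mul1n.
by move=> /(_ n); rewrite (eqqV fP (eulerf_unit 1)).
Qed.

End Positivity.

(** * Residue classes modulo 3 of the two eta quotients *)

Lemma dil3_coefs (X Y Z : fps int) n : Z = dil 3 X + 'q^2 * dil 3 Y ->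
  [/\ Z (3 * n)%N = X n, Z (3 * n + 1)%N = 0 & Z (3 * n + 2)%N = Y n].
Proof.
move=> ->; rewrite !fpsED !mulXnE; split.
- rewrite dilE //; case: ltnP => [|le]; rewrite ?addr0 //.
  by rewrite dil_out ?addr0 //; apply/negP => /dvdnP [m]; lia.
- rewrite [dil 3 X _]dil_out; last by apply/negP => /dvdnP [m]; lia.
  case: ltnP => [|le]; rewrite ?addr0 //.
  by rewrite dil_out ?addr0 //; apply/negP => /dvdnP [m]; lia.
- rewrite [dil 3 X _]dil_out; last by apply/negP => /dvdnP [m]; lia.
  by rewrite ltnNge leq_addl addnK add0r dilE.
Qed.

(** Squaring f_1^2 = f_2 phi gives f_1^4 = f_1 psi phi^2, and f_1 cancels. *)
Lemma f1_cube : f 1 ^+ 3 = phi ^+ 2 * psi.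
Proof.
apply: (mulIr (eulerf_unit 1)).
have -> : f 1 ^+ 3 * f 1 = (f 1 ^+ 2) ^+ 2 by ring.
by rewrite f1_sqr exprMn f2_sqr; ring.
Qed.

Lemma dil_f1V k : (0 < k)%N -> (f k)^-1 = dil k (f 1)^-1.
Proof. by move=> k0; rewrite rmorphV ?eulerf_unit //= dil_eulerf // muln1. Qed.

Lemma f1VE : (f 1)^-1 = psi * (f 2)^-1 ^+ 2.
Proof.
apply: (mulrI (eulerf_unit 1)); rewrite divrr ?eulerf_unit // mulrA -f2_sqr.
by rewrite -exprMn divrr ?eulerf_unit // expr1n.
Qed.

(** [f2_phi3] at q^2. The factor f_2 / f_4, shared with [dil2_thBE], absorbs the negative powers of
    f_2 in [f1VE]. *)
Lemma dil6_phiE : dil 6 phi = f 2 * dil 2 thA * (f 4)^-1.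
Proof.
have <- : f 4 * dil 6 phi = f 2 * dil 2 thA.
  rewrite -[f 2](@dil_eulerf 2 1 isT isT) -[f 4](@dil_eulerf 2 2 isT isT).
  by rewrite -(@dil_dil _ 2 3 phi isT) -!rmorphM f2_phi3.
by rewrite mulrC mulKr ?eulerf_unit.
Qed.

Lemma dil2_thBE : dil 2 thB = f 2 * dil 6 psi * (f 4)^-1.
Proof.
have <- : f 4 * dil 2 thB = f 2 * dil 6 psi.
  rewrite -[f 2](@dil_eulerf 2 1 isT isT) -[f 4](@dil_eulerf 2 2 isT isT).
  by rewrite -(@dil_dil _ 2 3 psi isT) -!rmorphM f2_thB.
by rewrite mulrC mulKr ?eulerf_unit.
Qed.

(** At q^2 the middle term moves to q^2, so the class 1 modulo 3 is empty; [dil 3] is put outermost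
    to suit [dil3_coefs]. *)
Lemma dil2_phiE : dil 2 phi = dil 3 (dil 6 phi) - 2 * 'q^2 * dil 3 (dil 2 thB).
Proof.
rewrite {1}phi_dissect rmorphB !rmorphM rmorph_nat /= dil_Xn //.
by rewrite (@dil_dil _ 2 9 phi isT) (@dil_dil _ 2 3 thB isT)
  (@dil_dil _ 3 6 phi isT) (@dil_dil _ 3 2 thB isT).
Qed.

Lemma dil2_psiE : dil 2 psi = dil 3 (dil 2 thA) + 'q^2 * dil 3 (dil 6 psi).
Proof.
rewrite {1}psi_dissect rmorphD rmorphM /= dil_Xn //.
by rewrite (@dil_dil _ 2 9 psi isT) (@dil_dil _ 2 3 thA isT)
  (@dil_dil _ 3 6 psi isT) (@dil_dil _ 3 2 thA isT).
Qed.

(** Since 1 / f_3 is a series in q^3, dividing by it preserves the dissection and amounts to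
    dividing each part by f_1. *)
Lemma dissect_f2_sqr : f 2 ^+ 2 * (f 3)^-1 * (f 4)^-1 =
  dil 3 (psi * (f 2)^-1 * (dil 2 thA * (f 4)^-1)) +
  'q^2 * dil 3 (- (psi * (f 2)^-1 * (dil 6 psi * (f 4)^-1 *+ 2))).
Proof.
have f2V : f 2 * (f 2)^-1 = 1 by rewrite divrr ?eulerf_unit.
have f4V : f 4 * (f 4)^-1 = 1 by rewrite divrr ?eulerf_unit.
have -> : f 2 ^+ 2 = f 4 * dil 2 phi.
  by rewrite -[f 2](@dil_eulerf 2 1) // -rmorphXn f1_sqr rmorphM /= dil_eulerf.
have -> : psi * (f 2)^-1 * (dil 2 thA * (f 4)^-1) = dil 6 phi * (f 1)^-1.
  by rewrite f1VE dil6_phiE; ring: f2V.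
have -> : - (psi * (f 2)^-1 * (dil 6 psi * (f 4)^-1 *+ 2)) =
          - (2 * dil 2 thB) * (f 1)^-1.
  by rewrite f1VE dil2_thBE; ring: f2V.
rewrite !rmorphM rmorphN rmorphM rmorph_nat /= -dil_f1V // dil2_phiE.
ring: f4V.
Qed.

Lemma dissect_f2_cube : f 2 ^+ 3 * (f 3)^-1 =
  dil 3 (psi * dil 2 thA * (f 4)^-1 * (dil 2 thA ^+ 2 * (f 4)^-1) +
         psi * (f 4)^-1 ^+ 2 * ('q^2 * dil 6 psi ^+ 3) *+ 4) +
  'q^2 * dil 3 (- (psi * dil 2 thA * (f 4)^-1 *
                   (dil 2 thA * dil 6 psi * (f 4)^-1 *+ 3))).
Proof.
have f2V : f 2 * (f 2)^-1 = 1 by rewrite divrr ?eulerf_unit.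
have -> : f 2 ^+ 3 = dil 2 phi ^+ 2 * dil 2 psi.
  by rewrite -[f 2](@dil_eulerf 2 1) // -rmorphXn f1_cube rmorphM rmorphXn.
set S := dil 6 phi; set T := dil 2 thB; set A := dil 2 thA; set V := dil 6 psi.
(* In (S - 2 q^2 T)^2 (A + q^2 V), taken at q^3 inside the letters, this relation kills the q^4 part
   4 T (T A - S V) and reduces the q^2 part S^2 V - 4 S T A to -3 S^2 V. *)
have TA : T * A = S * V by rewrite /S /T dil6_phiE dil2_thBE; ring.
have -> : psi * A * (f 4)^-1 * (A ^+ 2 * (f 4)^-1) +
    psi * (f 4)^-1 ^+ 2 * ('q^2 * V ^+ 3) *+ 4 =
    (S ^+ 2 * A + 4 * 'q^2 * T ^+ 2 * V) * (f 1)^-1.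
  by rewrite f1VE /S /T dil6_phiE dil2_thBE; ring: f2V.
have -> : - (psi * A * (f 4)^-1 * (A * V * (f 4)^-1 *+ 3)) =
    - (3 * S ^+ 2 * V) * (f 1)^-1.
  by rewrite f1VE /S dil6_phiE; ring: f2V.
rewrite dil2_phiE dil2_psiE -/S -/T -/A -/V.
have TA3 := congr1 (dil 3) TA; rewrite !rmorphM /= in TA3.
rewrite !(rmorph_nat, rmorphM, rmorphD, rmorphN, rmorphXn) /= -dil_f1V //.
(* Writing q^6 as (q^2)^3 leaves q^2 as the only power of q for [ring]. *)
rewrite dil_Xn // mulnC -expXn.
ring: TA3.
Qed.

Lemma eta_coef4 (t2 t3 t4 : int) n :
  eta_coef [:: 0; t2; t3; t4] n = (f 2 ^ t2 * f 3 ^ t3 * f 4 ^ t4) n.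
Proof.
congr (coefs _ n).
by rewrite !big_ord_recl big_ord0 expr0z mul1r mulr1 mulrA.
Qed.

Theorem theorem3p1 (t2 t3 t4 : int) (ht : (t2, t3, t4) \in S2) (n : nat) :
  [/\ 0 < eta_coef [:: 0; t2; t3; t4] (3 * n)%N,
      eta_coef [:: 0; t2; t3; t4] (3 * n + 1)%N = 0
    & eta_coef [:: 0; t2; t3; t4] (3 * n + 2)%N < 0].
Proof.
have psi2 : pos_below 2 psi by rewrite psi.unlock; exact: pos_below2_theta.
have thA2 : pos_below 2 thA by rewrite thA.unlock; exact: pos_below2_theta.
have [A0 A00] : nonneg (dil 2 thA) /\ 0 < dil 2 thA 0%N.
  by rewrite dil_coef0; split; [exact: nonneg_dil thA2.1 | exact: thA2.2].
have [V0 V00] : nonneg (dil 6 psi) /\ 0 < dil 6 psi 0%N.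
  by rewrite dil_coef0; split; [exact: nonneg_dil psi2.1 | exact: psi2.2].
have [f4V0 f4V00] : nonneg (f 4)^-1 /\ 0 < (f 4)^-1 0%N.
  rewrite dil_f1V // dil_coef0; split; last exact: positive_f1V.
  exact/nonneg_dil/positiveW/positive_f1V.
have psif2 : positive (psi * (f 2)^-1).
  by rewrite dil_f1V //; apply: positive_dilM positive_f1V.
have psif4 : positive (psi * dil 2 thA * (f 4)^-1).
  rewrite dil_f1V //; apply: positive_dilM positive_f1V => //.
  (* Both psi and A start with 1 + q, so psi(q) A(q^2) is positive in degrees below 2 * 2. *)
  exact: (@pos_belowM 2 2).
rewrite !inE in ht; case/orP: ht => /eqP[-> -> ->].
  have E m : eta_coef [:: 0; 2; -1; -1] m = (f 2 ^+ 2 * (f 3)^-1 * (f 4)^-1) m.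
    by rewrite eta_coef4 !exprN1.
  rewrite !E; have [-> -> ->] := dil3_coefs n dissect_f2_sqr.
  rewrite fpsEN oppr_lt0; split=> //.
    (* Beside a factor positive in all degrees, the cofactor needs only nonnegativity and a positive
       constant term. *)
    by apply: positiveM; [|exact: nonnegM|exact: coef0M_gt0].
  rewrite mulrnAr; apply: positive_mulrn.
  by apply: positiveM; [|exact: nonnegM|exact: coef0M_gt0].
have E m : eta_coef [:: 0; 3; -1; 0] m = (f 2 ^+ 3 * (f 3)^-1) m.
  by rewrite eta_coef4 exprN1 expr0z mulr1.
rewrite !E; have [-> -> ->] := dil3_coefs n dissect_f2_cube.
rewrite fpsEN oppr_lt0; split=> //.
  (* The summand with the factor q^2 is only shown nonnegative; strictness comes from the other
     one. *)
  apply: positive_nonnegD.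
    apply: positiveM => //; first by apply: nonnegM => //; apply: nonnegX.
    by apply: coef0M_gt0 => //; [apply: nonnegX | apply: coef0M_gt0].
  apply/nonneg_mulrn/nonnegM; apply: nonnegM; try exact: nonnegX.
    exact: psi2.1.
  exact: nonneg_Xn.
rewrite mulrnAr; apply: positive_mulrn.
apply: positiveM => //; first by apply: nonnegM => //; apply: nonnegM.
by do 2?apply: coef0M_gt0 => //; apply: nonnegM.
Qed.
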